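(* There exists a finite set $V\subset\mathbb{R}^2$ such that the odd-distance graph on $V$ has chromatic number exactly $6$.
   Context: For a set $V\subset\mathbb{R}^2$, the odd-distance graph on $V$ is the graph with vertex set $V$ in which two distinct vertices are joined by an edge if and only if their Euclidean distance is an odd integer. The chromatic number is the least number of colors in a proper vertex coloring (adjacent vertices receive different colors). *)

(* Defs.v *)
From HB Require Import structures.
From mathcomp Require Import all_boot all_order all_algebra.
From mathcomp Require Import boolp classical_sets functions cardinality reals.

Set Implicit Arguments.
Unset Strict Implicit.
Unset Printing Implicit Defensive.

Import Order.TTheory GRing.Theory Num.Theory.
Local Open Scope classical_set_scope.
Local Open Scope ring_scope.

(* The norm that MathComp-Analysis puts on ['rV[R]_n] is the sup norm, hence
   this explicit Euclidean distance. *)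
Definition euclidean_dist (R : realType) (x y : 'rV[R]_2) : R :=
  Num.sqrt (\sum_(i < 2) (x ord0 i - y ord0 i) ^+ 2).

Definition odd_integer (R : realType) (r : R) : Prop :=
  exists k : int, r = (2 * k + 1)%:~R.

(* A graph is given by its adjacency relation on its type of vertices; here
   [V] is coerced to the subtype of the points of the plane lying in [V]. *)
Definition odd_distance_graph (R : realType) (V : set 'rV[R]_2) :
    V -> V -> Prop :=
  fun x y => x <> y /\ odd_integer (euclidean_dist (val x) (val y)).

Arguments odd_distance_graph {R} V x y.

Definition proper_coloring (T C : Type) (adj : T -> T -> Prop) (c : T -> C) :
    Prop :=
  forall x y : T, adj x y -> c x <> c y.

Definition colorable (T : Type) (adj : T -> T -> Prop) (k : nat) : Prop :=
  exists c : T -> 'I_k, proper_coloring adj c.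

Definition has_chromatic_number (T : Type) (adj : T -> T -> Prop) (k : nat) :
    Prop :=
  colorable adj k /\ forall j : nat, colorable adj j -> (k <= j)%N.

(* Main.v *)
(** Let [z = (1 + sqrt (-15)) / 4], a complex number of modulus 1 with
    [z + 1/z = 1/2]. For [i < m < j] one gets a relation [b z^m = a z^i + c z^j]
    with integers [b] odd and [a], [c] even. Hence a character of the group
    spanned by the powers of [z] cannot take the value -1 on three of them, so
    that the spectral projections onto the functions that change sign under the
    translation by [z^l] have vanishing triple products and their sum is at
    most 2. On the other hand, a set without odd distances meets every line of
    direction [z^l] in points of one parity only, so its indicator has the same
    energy in this projection as in the averages along the line; for a partition
    into [k] such sets these energies add up to a proportion at least [1/k].
    With [L] directions, [L/k <= 2]: no finite number of colours suffices. The
    projections are replaced by averages over [N] steps, and the lattice by a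
    large torus. Finally, adding a point to a set raises the chromatic number
    by at most 1. *)
Require Import Defs.
From HB Require Import structures.
From mathcomp Require Import all_boot all_order all_algebra.
From mathcomp Require Import boolp classical_sets functions cardinality reals.
From mathcomp Require Import ring lra zify.

Set Implicit Arguments.
Unset Strict Implicit.
Unset Printing Implicit Defensive.

Import Order.TTheory GRing.Theory Num.Theory.
Local Open Scope ring_scope.

(** * Alternating averages on a finite abelian group *)

Section AlternatingAverages.
Variables (R : realFieldType) (G : finZmodType).
Implicit Types (f g h : G -> R) (v w x : G).

Definition dot f g : R := \sum_x f x * g x.

Lemma sum_cauchy_schwarz (I : finType) (f g : I -> R) :
  (\sum_i f i * g i) ^+ 2 <= (\sum_i f i ^+ 2) * (\sum_i g i ^+ 2).
Proof.
set a := \sum_i f i ^+ 2; set b := \sum_i f i * g i; set c := \sum_i g i ^+ 2.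
have a_ge0 : 0 <= a by apply: sumr_ge0 => i _; apply: sqr_ge0.
have quad t : 0 <= t ^+ 2 * a - 2 * t * b + c.
  rewrite /a /b /c !mulr_sumr -sumrB -big_split /=.
  apply: sumr_ge0 => i _.
  rewrite (_ : _ + _ = (t * f i - g i) ^+ 2) ?sqr_ge0 //; ring.
have [a0|a_neq0] := eqVneq a 0.
  have f0 i : f i = 0.
    move/eqP: a0; rewrite psumr_eq0; last by move=> j _; apply: sqr_ge0.
    by move/allP/(_ i (mem_index_enum i)); rewrite sqrf_eq0 => /eqP.
  by rewrite a0 mul0r /b big1 ?expr0n // => i _; rewrite f0 mul0r.
have a_gt0 : 0 < a by rewrite lt_neqAle eq_sym a_neq0.
have /(mulr_ge0 a_ge0) := quad (b / a).
have -> : a * ((b / a) ^+ 2 * a - 2 * (b / a) * b + c) = a * c - b ^+ 2.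
  by field.
by rewrite subr_ge0.
Qed.

Lemma dotE f : dot f f = \sum_x f x ^+ 2.
Proof. by apply: eq_bigr => x _; rewrite expr2. Qed.

Lemma dot_ge0 f : 0 <= dot f f.
Proof. by rewrite dotE; apply: sumr_ge0 => x _; apply: sqr_ge0. Qed.

Lemma dotC f g : dot f g = dot g f.
Proof. by apply: eq_bigr => x _; rewrite mulrC. Qed.

Lemma dot_cauchy_schwarz f g : dot f g ^+ 2 <= dot f f * dot g g.
Proof. by rewrite !dotE; apply: sum_cauchy_schwarz. Qed.

Lemma dot_sumr (I : finType) (P : pred I) f (g : I -> G -> R) :
  dot f (fun x => \sum_(i | P i) g i x) = \sum_(i | P i) dot f (g i).
Proof.
by rewrite /dot exchange_big /=; apply: eq_bigr => x _; rewrite mulr_sumr.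
Qed.

(* Both [sum_i <f, D_i C_i f>] and the square norm of [sum_i D_i C_i f] are
   computed by expansion; Cauchy-Schwarz compares them. *)
Lemma bessel (I : finType) (P : pred I) (C D : I -> (G -> R) -> G -> R) f :
  (forall i g h, dot (C i g) h = dot g (D i h)) ->
  (forall i g, dot (D i g) (D i g) <= dot g g) ->
  forall e, e = \sum_(i | P i) dot (C i f) (C i f) ->
  e ^+ 2 <= dot f f * (e + \sum_(i | P i) \sum_(j | P j && (j != i))
                             dot (D i (C i f)) (D j (C j f))).
Proof.
move=> adj contr e def_e.
have {1}-> : e = dot f (fun x => \sum_(i | P i) D i (C i f) x).
  by rewrite def_e dot_sumr; apply: eq_bigr => i _; rewrite adj.
apply: le_trans (dot_cauchy_schwarz _ _) _.
apply: ler_wpM2l; first exact: dot_ge0.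
rewrite dot_sumr def_e -big_split /=.
apply: ler_sum => i Pi.
rewrite dotC dot_sumr (bigD1 i) //=; by apply: lerD.
Qed.

Variable N : nat.
Hypothesis N_gt0 : (0 < N)%N.

(** For large [N] this is close to the spectral projection onto the functions [g] with
    [g (x + v) = - g x]. *)
Definition alt v f x : R := N%:R^-1 * \sum_(j < N) (-1) ^+ j * f (x + v *+ j).

Let NR_gt0 : 0 < N%:R :> R. Proof. by rewrite ltr0n. Qed.

Lemma sum_shift v f : \sum_x f (x + v) = \sum_x f x.
Proof.
by rewrite [RHS](reindex_inj (h := fun x => x + v)) //; apply: addIr.
Qed.

Lemma dot_alt v f g : dot (alt v f) g = dot f (alt (- v) g).
Proof.
rewrite /dot /alt.
under eq_bigr do rewrite -mulrA mulr_suml.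
under [RHS]eq_bigr do rewrite mulrCA mulr_sumr.
rewrite -!mulr_sumr; congr (_ * _).
rewrite exchange_big [RHS]exchange_big /=; apply: eq_bigr => j _.
rewrite -[RHS](sum_shift (v *+ j)); apply: eq_bigr => x _.
by rewrite mulNrn addrK; ring.
Qed.

Lemma altC v w f : alt v (alt w f) = alt w (alt v f).
Proof.
apply: funext => x; rewrite /alt; congr (_ * _).
under eq_bigr do rewrite mulrCA mulr_sumr.
under [RHS]eq_bigr do rewrite mulrCA mulr_sumr.
rewrite -!mulr_sumr; congr (_ * _).
rewrite exchange_big /=; apply: eq_bigr => j _; apply: eq_bigr => i _.
by rewrite mulrCA addrAC.
Qed.

(** Cauchy-Schwarz bounds the square of an average by the average of the squares, and translation
    preserves the norm. *)
Lemma alt_contract v f : dot (alt v f) (alt v f) <= dot f f.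
Proof.
rewrite !dotE.
apply: (@le_trans _ _ (\sum_x N%:R^-1 * \sum_(j < N) f (x + v *+ j) ^+ 2)).
  apply: ler_sum => x _; rewrite /alt exprMn expr2 -mulrA.
  apply: ler_wpM2l; first by rewrite invr_ge0 ltW.
  rewrite mulrC ler_pdivrMr //.
  apply: le_trans (sum_cauchy_schwarz _ _) _.
  rewrite mulrC; under [X in _ * X <= _]eq_bigr do rewrite -exprM mulnC exprM sqrrN expr1n expr1n.
  by rewrite sumr_const card_ord.
rewrite -mulr_sumr exchange_big /=.
under eq_bigr do rewrite (sum_shift _ (fun x => f x ^+ 2)).
by rewrite sumr_const card_ord -[X in _ * X]mulr_natl mulKf ?lt0r_neq0.
Qed.

Definition bounded_by (e : R) f := forall x, `|f x| <= e.

Lemma bounded_alt e v f : bounded_by e f -> bounded_by e (alt v f).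
Proof.
move=> fe x; rewrite /alt normrM ger0_norm ?invr_ge0 ?ler0n //.
rewrite [leLHS]mulrC ler_pdivrMr //; apply: le_trans (ler_norm_sum _ _ _) _.
apply: (@le_trans _ _ (\sum_(j < N) e)).
  by apply: ler_sum => j _; rewrite normrM normrX normrN1 expr1n mul1r.
by rewrite sumr_const card_ord mulr_natr.
Qed.

Lemma alternating_telescope (F : nat -> R) n :
  \sum_(j < n) (-1) ^+ j * (F j.+1 + F j) = F 0%N - (-1) ^+ n * F n.
Proof.
elim: n => [|n IHn]; first by rewrite big_ord0 expr0 mul1r subrr.
by rewrite big_ord_recr /= IHn exprS; ring.
Qed.

(** The sum telescopes to its two end terms, each at most 1 in absolute value. *)
Lemma alt_shift1 v f x : bounded_by 1 f ->
  `|alt v f (x + v) + alt v f x| <= 2 / N%:R.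
Proof.
move=> f1; rewrite /alt -mulrDr mulrC normrM (@ger0_norm _ N%:R^-1) ?invr_ge0 ?ler0n //.
apply: ler_wpM2r; first by rewrite invr_ge0 ltW.
rewrite -big_split /=.
under eq_bigr do rewrite -mulrDr -addrA -mulrS.
rewrite (alternating_telescope (fun j => f (x + v *+ j))).
apply: le_trans (ler_normB _ _) _; rewrite normrM normrX normrN1 expr1n mul1r.
exact: lerD.
Qed.

Lemma alt_shiftn v f x n : bounded_by 1 f ->
  `|alt v f (x + v *+ n) - (-1) ^+ n * alt v f x| <= 2 * n%:R / N%:R.
Proof.
move=> f1; elim: n => [|n IHn].
  by rewrite mulr0n addr0 expr0 mul1r subrr normr0 mulr0 mul0r.
have := alt_shift1 v (x + v *+ n) f1.
rewrite -addrA -mulrSr => H.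
rewrite (_ : _ - _ = (alt v f (x + v *+ n.+1) + alt v f (x + v *+ n)) -
   (alt v f (x + v *+ n) - (-1) ^+ n * alt v f x)); last by rewrite exprS; ring.
apply: le_trans (ler_normB _ _) _.
rewrite [leRHS](_ : _ = 2 / N%:R + 2 * n%:R / N%:R); first exact: lerD.
by rewrite -natr1; ring.
Qed.

Lemma alt_shiftz v f x (m : int) : bounded_by 1 f ->
  `|alt v f (x + v *~ m) - (-1) ^+ `|m|%N * alt v f x| <= 2 * `|m|%:R / N%:R.
Proof.
move=> f1; case: m => n; first exact: alt_shiftn.
have := alt_shiftn v (x + v *~ Negz n) n.+1 f1.
rewrite NegzE mulrNz -pmulrn subrK abszN absz_nat -(signr_odd _ n.+1).
case: (odd _); first by rewrite !mulN1r !opprK addrC.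
by rewrite !mul1r distrC.
Qed.

(* On the range of [alt u] the shift by [u] is almost [-1]; so the relation
   makes the same shift almost [1] and almost [-1] on the triple product. *)
Lemma alt3_small (u v w : G) (a b c : int) f :
  ~~ odd `|a| -> odd `|b| -> ~~ odd `|c| -> v *~ b = u *~ a + w *~ c ->
  bounded_by 1 f ->
  bounded_by ((`|a| + `|b| + `|c|)%N%:R / N%:R) (alt u (alt v (alt w f))).
Proof.
move=> a_even b_odd c_even rel f1 x.
set h := alt u _.
have hv : h = alt v (alt u (alt w f)) by rewrite /h altC.
have hw : h = alt w (alt u (alt v f)).
  by rewrite /h [alt v _]altC altC.
have Eu := @alt_shiftz u (alt v (alt w f)) (x + w *~ c) a
  (bounded_alt v (bounded_alt w f1)).
have Ev := @alt_shiftz v (alt u (alt w f)) x b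
  (bounded_alt u (bounded_alt w f1)).
have Ew := @alt_shiftz w (alt u (alt v f)) x c
  (bounded_alt u (bounded_alt v f1)).
rewrite -/h -signr_odd (negbTE a_even) expr0 mul1r in Eu.
rewrite -hv -signr_odd b_odd expr1 mulN1r opprK rel in Ev.
rewrite -hw -signr_odd (negbTE c_even) expr0 mul1r in Ew.
rewrite -addrA [w *~ c + _]addrC in Eu.
have : `|2 * h x| <= 2 * ((`|a| + `|b| + `|c|)%N%:R / N%:R).
  set y := h (x + (u *~ a + w *~ c)) in Eu Ev.
  rewrite (_ : 2 * h x = (y + h x) - (y - h (x + w *~ c)) - (h (x + w *~ c) - h x)); last by ring.
  apply: le_trans (ler_normB _ _) _; apply: le_trans (lerD (ler_normB _ _) (lexx _)) _.
  by rewrite !natrD; lra.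
by rewrite normrM ger0_norm // ler_pM2l.
Qed.

Lemma dot_le_card e f g : 0 <= e -> bounded_by e f -> bounded_by 1 g ->
  dot f g <= e *+ #|G|.
Proof.
move=> e_ge0 fe g1; rewrite -sumr_const; apply: ler_sum => x _.
apply: le_trans (ler_norm _) _; rewrite normrM -[leRHS]mulr1.
by apply: ler_pM.
Qed.

Lemma sum_neq_sym (L : nat) (Y : 'I_L -> 'I_L -> R) :
  (forall i j, Y i j = Y j i) ->
  \sum_i \sum_(j | j != i) Y i j =
    2 * \sum_(p : 'I_L * 'I_L | (p.1 < p.2)%N) Y p.1 p.2.
Proof.
move=> Ysym.
rewrite -(pair_big_dep xpredT (fun i j : 'I_L => (i < j)%N) Y) /=.
rewrite mulr_natl mulr2n.
rewrite [X in _ = _ + X](exchange_big_dep xpredT) //= -big_split /=.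
apply: eq_bigr => i _.
rewrite (bigID (fun j : 'I_L => (i < j)%N)) /=; congr (_ + _).
  by apply: eq_bigl => j; rewrite neq_ltn; case: ltngtP.
under [RHS]eq_bigr do rewrite Ysym.
by apply: eq_bigl => j; rewrite -(inj_eq val_inj) /=; case: ltngtP.
Qed.

(** * Energy bound for directions with parity relations *)

Section Directions.
Variables (L C : nat) (v : 'I_L -> G).
Hypothesis relation : forall i k j : 'I_L, (i < k < j)%N ->
  exists a b c : int, [/\ ~~ odd `|a|, odd `|b|, ~~ odd `|c|,
    v k *~ b = v i *~ a + v j *~ c & (`|a| + `|b| + `|c| <= C)%N].

Let eta : R := C%:R / N%:R.

Let eta_ge0 : 0 <= eta. Proof. by rewrite divr_ge0. Qed.

Lemma alt3_sorted (i k j : 'I_L) f : (i < k < j)%N -> bounded_by 1 f ->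
  bounded_by eta (alt (v i) (alt (v k) (alt (v j) f))).
Proof.
move=> /relation[a [b [c [a_even b_odd c_even rel le_C]]]] f1 x.
apply: le_trans (alt3_small a_even b_odd c_even rel f1 x) _.
by apply: ler_wpM2r; rewrite ?invr_ge0 ?ler0n ?ler_nat.
Qed.

Lemma alt3_distinct (c a b : 'I_L) f : (a < b)%N -> c != a -> c != b ->
  bounded_by 1 f -> bounded_by eta (alt (v c) (alt (v a) (alt (v b) f))).
Proof.
move=> ab; rewrite !neq_ltn => /orP[ca _|ac /orP[cb|bc]] f1.
- by apply: alt3_sorted; rewrite ?ca.
- by rewrite (altC (v c)); apply: alt3_sorted; rewrite ?ac.
- by rewrite 2!(altC (v c)); apply: alt3_sorted; rewrite ?ab.
Qed.

(** One of [c], [d] lies outside [{a, b}]. Commuting its average inwards forms a small triple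
    product with [v a] and [v b]; the averages left outside keep the bound. *)
Lemma alt_pairs_small (a b c d : 'I_L) f : (a < b)%N -> (c < d)%N ->
  (c, d) != (a, b) -> bounded_by 1 f ->
  bounded_by eta (alt (v c) (alt (v d)
    (alt (- v a) (alt (- v b) (alt (v a) (alt (v b) f)))))).
Proof.
move=> ab cd ne f1.
have [/andP[ca cb]|c_ab] := boolP ((c != a) && (c != b)).
  rewrite 3!(altC (v c)).
  by do 3 apply: bounded_alt; apply: alt3_distinct.
have /andP[da db] : (d != a) && (d != b).
  move: ne c_ab; rewrite xpair_eqE -!val_eqE /=; lia.
rewrite 2!(altC (v d)).
by do 3 apply: bounded_alt; apply: alt3_distinct.
Qed.

(** Bessel for the products over pairs: at most [L ^ 4] cross terms, each at most [eta *+ #|G|].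
    With [s = dot f f], the resulting [e^2 <= s (e + kappa)] forces [e <= s + kappa]. *)
Lemma pair_energy_le f : bounded_by 1 f ->
  \sum_(p : 'I_L * 'I_L | (p.1 < p.2)%N)
     dot (alt (v p.1) (alt (v p.2) f)) (alt (v p.1) (alt (v p.2) f))
  <= dot f f + eta *+ #|G| *+ (L ^ 4).
Proof.
move=> f1; set e := \sum_(_ | _) _; set kappa := eta *+ #|G| *+ (L ^ 4).
have kappa_ge0 : 0 <= kappa by rewrite !mulrn_wge0.
pose Cp (p : 'I_L * 'I_L) g := alt (v p.1) (alt (v p.2) g).
pose Dp (p : 'I_L * 'I_L) g := alt (- v p.1) (alt (- v p.2) g).
have adj p g h : dot (Cp p g) h = dot g (Dp p h).
  by rewrite /Cp /Dp !dot_alt altC.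
have contr p g : dot (Dp p g) (Dp p g) <= dot g g.
  by apply: le_trans (alt_contract _ _) _; apply: alt_contract.
have := bessel (P := fun p : 'I_L * 'I_L => (p.1 < p.2)%N) (f := f) adj contr (erefl _).
rewrite -/e; set X := \sum_(_ | _) \sum_(_ | _) _ => e_sq.
have X_le : X <= kappa.
  apply: (@le_trans _ _ (\sum_(p : 'I_L * 'I_L) \sum_(q : 'I_L * 'I_L) eta *+ #|G|)).
    rewrite /X big_mkcond; apply: ler_sum => p _; case: ifP => p_lt; last first.
      by apply: sumr_ge0 => q _; rewrite mulrn_wge0.
    rewrite big_mkcond; apply: ler_sum => q _; case: ifP => [/andP[q_lt qp]|_]; last first.
      by rewrite mulrn_wge0.
    rewrite -adj; apply: dot_le_card => //.
      by apply: alt_pairs_small => //; move: qp; rewrite -!surjective_pairing.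
    by do 2 apply: bounded_alt.
  by rewrite !sumr_const card_prod card_ord /kappa -[leLHS]mulrnA !mulnn -expnM.
have s_ge0 := dot_ge0 f.
have e_sq' : e ^+ 2 <= dot f f * (e + kappa).
  by apply: le_trans e_sq _; apply: ler_wpM2l => //; apply: lerD.
by rewrite leNgt; apply/negP => lt_e; nra.
Qed.

(** The cross terms in Bessel are exactly the pair energies, each counted twice, so
    [e^2 <= s (e + 2 (s + kappa))] with [s = dot f f]. The factor 2 is the positive root of
    [t^2 = t + 2]. *)
Lemma energy_le f : bounded_by 1 f ->
  \sum_i dot (alt (v i) f) (alt (v i) f)
  <= 2 * dot f f + eta *+ #|G| *+ (L ^ 4).
Proof.
move=> f1; set e := \sum_i _; set kappa := eta *+ #|G| *+ (L ^ 4).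
have kappa_ge0 : 0 <= kappa by rewrite !mulrn_wge0.
have := bessel (P := xpredT) (f := f) (fun i : 'I_L => dot_alt (v i))
  (fun i => alt_contract (- v i)) (erefl _).
rewrite -/e /=.
under eq_bigr => i _ do under eq_bigr => j _ do
  rewrite -dot_alt (altC (v j)) dotC -dot_alt (altC (v j)).
rewrite (@sum_neq_sym L (fun i j => dot (alt (v i) (alt (v j) f)) (alt (v i) (alt (v j) f)))); last first.
  by move=> i j; rewrite (altC (v i)).
have := pair_energy_le f1; rewrite -/kappa.
set e2 := \sum_(_ | _) _ => e2_le e_sq.
have s_ge0 := dot_ge0 f.
have e_sq' : e ^+ 2 <= dot f f * (e + 2 * (dot f f + kappa)).
  by apply: le_trans e_sq _; apply: ler_wpM2l => //; apply: lerD => //; apply: ler_wpM2l.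
by rewrite leNgt; apply/negP => lt_e; nra.
Qed.

End Directions.

(** * Energies of colour classes *)

Section Colorings.
Variables (k : nat) (col : G -> 'I_k).

Let ind (c : 'I_k) y : R := (col y == c)%:R.

Let sum_ind y : \sum_c ind c y = 1.
Proof.
rewrite (bigD1 (col y)) //= /ind eqxx big1 ?addr0 // => c.
by rewrite eq_sym => /negPf ->.
Qed.

Let ind_bounded c : bounded_by 1 (ind c).
Proof. by move=> y; rewrite /ind; case: eqP; rewrite ?normr1 ?normr0. Qed.

(* The points of colour [c] among the [x + v *+ j] all have [j] of the same
   parity, so the alternating average of [ind c] is its average up to sign. *)
Lemma alt_color_mass v x :
  (forall i j, (i < N)%N -> (j < N)%N -> odd i != odd j ->
     col (x + v *+ i) != col (x + v *+ j)) ->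
  k%:R^-1 <= \sum_c alt v (ind c) x ^+ 2.
Proof.
move=> proper.
pose avg c : R := N%:R^-1 * \sum_(j < N) ind c (x + v *+ j).
have alt_avg c : alt v (ind c) x ^+ 2 = avg c ^+ 2.
  rewrite /alt /avg !exprMn; congr (_ * _).
  have [/existsP[i /eqP ci]|none] :=
    boolP [exists i : 'I_N, col (x + v *+ i) == c]; last first.
    have ncol (j : 'I_N) : ind c (x + v *+ j) = 0.
      by rewrite /ind; case: eqP => // cj; case/existsP: none; exists j; apply/eqP.
    by rewrite !big1 // => j _; rewrite ncol ?mulr0.
  have -> : \sum_(j < N) (-1) ^+ j * ind c (x + v *+ j) =
            (-1) ^+ i * \sum_(j < N) ind c (x + v *+ j).
    rewrite mulr_sumr; apply: eq_bigr => j _; rewrite /ind.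
    case: eqP => [cj|]; last by rewrite !mulr0.
    rewrite -signr_odd -[in RHS]signr_odd; congr ((-1) ^+ _ * _).
    congr nat_of_bool; apply/eqP; rewrite eq_sym; apply/negPn/negP => ne.
    by have := proper _ _ (ltn_ord i) (ltn_ord j) ne; rewrite ci cj eqxx.
  by rewrite exprMn sqrr_sign mul1r.
under eq_bigr do rewrite alt_avg.
(* The [k] averages sum to 1, so by Cauchy-Schwarz their squares sum to at least [1/k]. *)
have avg1 : \sum_c 1 * avg c = 1.
  under eq_bigr do rewrite mul1r.
  rewrite /avg -mulr_sumr exchange_big /=.
  under eq_bigr do rewrite sum_ind.
  by rewrite sumr_const card_ord mulVf ?lt0r_neq0.
have := sum_cauchy_schwarz (fun _ => 1) avg; rewrite avg1 expr1n /=.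
rewrite sumr_const card_ord => le1.
have k_gt0 : 0 < k%:R :> R by rewrite ltr0n; case: k (col x) => [[]|].
by rewrite -div1r ler_pdivrMr // mulrC.
Qed.

(** The total energy over all colours and directions is bounded below by [alt_color_mass] at the
    points of [S] and above by [energy_le]. [S] will consist of points far from the edge, whose
    translates do not wrap around the torus. *)
Lemma color_count (L C : nat) (v : 'I_L -> G) (S : {set G}) :
  (forall i m j : 'I_L, (i < m < j)%N ->
    exists a b c : int, [/\ ~~ odd `|a|, odd `|b|, ~~ odd `|c|,
      v m *~ b = v i *~ a + v j *~ c & (`|a| + `|b| + `|c| <= C)%N]) ->
  (forall x l i j, x \in S -> (i < N)%N -> (j < N)%N -> odd i != odd j ->
     col (x + v l *+ i) != col (x + v l *+ j)) ->
  L%:R * #|S|%:R / k%:R <= (2 + k%:R * (C%:R / N%:R) * (L ^ 4)%:R) * #|G|%:R :> R.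
Proof.
move=> relation proper.
apply: (@le_trans _ _ (\sum_c \sum_i dot (alt (v i) (ind c)) (alt (v i) (ind c)))).
  rewrite exchange_big /= -mulrA mulr_natl -[X in _ *+ X](card_ord L) -sumr_const.
  apply: ler_sum => i _; rewrite /dot exchange_big /=.
  rewrite mulr_natl -sumr_const big_mkcond; apply: ler_sum => x _.
  under eq_bigr do rewrite -expr2.
  case: ifP => [xS|_]; last by apply: sumr_ge0 => c _; apply: sqr_ge0.
  by apply: alt_color_mass => *; apply: proper.
apply: le_trans (ler_sum _ (fun c _ => energy_le relation (ind_bounded c))) _.
rewrite big_split /= -mulr_sumr.
have -> : \sum_c dot (ind c) (ind c) = #|G|%:R.
  rewrite exchange_big /= -sum1_card natr_sum; apply: eq_bigr => x _.
  rewrite -(sum_ind x); apply: eq_bigr => c _.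
  by rewrite /ind; case: eqP; rewrite ?mulr1 ?mulr0.
rewrite sumr_const card_ord -[_ *+ k]mulr_natl -[_ *+ L ^ 4]mulr_natl -[_ *+ #|G|]mulr_natl.
by rewrite le_eqVlt; apply/orP; left; apply/eqP; ring.
Qed.

End Colorings.
End AlternatingAverages.

(** * Integer relations between the powers of [z] *)

(* [z^n = 2^(1-n) (osq n) z - 2^(2-n) osq (n-1)] for [n > 0]; the recurrence is
   that of [z^2 = z/2 - 1] after clearing denominators. *)
Fixpoint osq (n : nat) : int :=
  match n with
  | 0 => 0
  | p.+1 => if p is m.+1 then osq p - 4 * osq m else 1
  end.

Lemma osqSS n : osq n.+2 = osq n.+1 - 4 * osq n. Proof. by []. Qed.

Lemma odd_osq n : odd `|osq n.+1|.
Proof.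
elim: n => [|n IHn] //; move: (osq n.+1) (osqSS n) IHn => a ->.
by lia.
Qed.

Lemma osq_docagne d e :
  osq d.+1 * osq (e + d) = osq d * osq (e + d).+1 + 4 ^+ d * osq e.
Proof.
elim: d => [|d IHd]; first by rewrite addn0 expr0 !mul1r mul0r add0r.
rewrite addnS !osqSS exprS.
rewrite (_ : 4 * 4 ^+ d * osq e = 4 * (osq d.+1 * osq (e + d) - osq d * osq (e + d).+1)).
  by ring.
by rewrite IHd; ring.
Qed.

(** Vajda's identity for the Lucas sequence with parameters 1 and 4. Both sides obey the recurrence
    of [osq] in [n], which leaves the cases 0 and 1; the latter is [osq_docagne]. *)
Lemma osq_vajda n d e :
  osq (n + d) * osq (e + d) = osq d * osq (n + e + d) + 4 ^+ d * osq n * osq e.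
Proof.
have [] : osq (n + d) * osq (e + d)
       = osq d * osq (n + e + d) + 4 ^+ d * osq n * osq e /\
     osq (n.+1 + d) * osq (e + d)
       = osq d * osq (n.+1 + e + d) + 4 ^+ d * osq n.+1 * osq e; last by [].
elim: n => [|n [IH0 IH1]]; first by rewrite !add0n !add1n addSn osq_docagne; split; ring.
split => //; rewrite !addSn !osqSS.
transitivity (osq (n.+1 + d) * osq (e + d) - 4 * (osq (n + d) * osq (e + d))).
  by rewrite addSn; ring.
by rewrite IH0 IH1 !addSn; ring.
Qed.

(** This is [|z^n| = 1]: the left side is the squared modulus of [2^n z^n], written in the basis
    [(1, 2z)]. *)
Lemma osq_norm n :
  (osq n.+1 - osq n) ^+ 2 + (osq n.+1 - osq n) * osq n + 4 * osq n ^+ 2 = 4 ^+ n.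
Proof. by elim: n => [|n IHn] //; rewrite [RHS]exprS -IHn osqSS; ring. Qed.

(* The coordinates of [2^L z^n] in the basis [(1, 2z)]. *)
Definition dirx L n : int := 2 ^+ (L - n) * (osq n.+1 - osq n).
Definition diry L n : int := 2 ^+ (L - n) * osq n.

(** The relation between [z^i], [z^(i+d)] and [z^(i+d+e)]. Coordinates are linear in [osq n] and
    [osq n.+1], so [osq_vajda] at [i] and [i.+1] suffices. *)
Lemma dir_relation L i d e : (i + d + e <= L)%N ->
  (dirx L (i + d) * osq (d + e) =
     dirx L i * (2 ^+ d * osq e) + dirx L (i + d + e) * (2 ^+ e * osq d)) /\
  (diry L (i + d) * osq (d + e) =
     diry L i * (2 ^+ d * osq e) + diry L (i + d + e) * (2 ^+ e * osq d)).
Proof.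
move=> leL.
have pow2 : 2 ^+ (L - i) = 2 ^+ (L - (i + d)) * 2 ^+ d :> int.
  by rewrite -exprD; congr (_ ^+ _); lia.
have pow2' : 2 ^+ (L - (i + d)) = 2 ^+ (L - (i + d + e)) * 2 ^+ e :> int.
  by rewrite -exprD; congr (_ ^+ _); lia.
have step n : osq (n + d) * osq (d + e) =
    2 ^+ d * 2 ^+ d * osq n * osq e + osq (n + d + e) * osq d.
  rewrite [(d + e)%N]addnC osq_vajda -exprD addnAC.
  by rewrite (_ : 4 = 2 ^+ 2) // -exprM mulnC muln2 -addnn; ring.
have := step i.+1; rewrite !addSn => step1.
rewrite /dirx /diry pow2; split.
  transitivity (2 ^+ (L - (i + d)) * (osq (i + d).+1 * osq (d + e) - osq (i + d) * osq (d + e))); first by ring.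
  by rewrite step step1 pow2'; ring.
transitivity (2 ^+ (L - (i + d)) * (osq (i + d) * osq (d + e))); first by ring.
by rewrite step pow2'; ring.
Qed.

(** * The lattice in the plane and its torus *)

(* Makes the product a [finZmodType]. *)
HB.instance Definition _ n := Finite.on ('I_n.+2 * 'I_n.+2)%type.

Section Plane.
Variable R : realType.

(* The complex number [(a + 2 b z) / 2^L]. *)
Definition point L (a b : int) : 'rV[R]_2 :=
  \row_i ((if i == 0 then a%:~R + b%:~R / 2 else b%:~R * (Num.sqrt 15 / 2)) / 2 ^+ L).

(** The displacement is [m z^n], and [z^n] has modulus 1 by [osq_norm]. *)
Lemma dist_point L n (a b m : int) : (n <= L)%N ->
  euclidean_dist (point L (a + dirx L n * m) (b + diry L n * m)) (point L a b)
  = `|m|%:~R.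
Proof.
move=> nL; rewrite /euclidean_dist !big_ord_recl big_ord0 !mxE /= addr0.
rewrite intr_norm -sqrtr_sqr; congr Num.sqrt.
have sqrt15 : Num.sqrt 15 ^+ 2 = 15 :> R by rewrite sqr_sqrtr.
have pow2L : 2 ^+ L = 2 ^+ (L - n) * 2 ^+ n :> R by rewrite -exprD subnK.
have normR := congr1 (fun z : int => z%:~R : R) (osq_norm n).
have pow4 : 4 ^+ n = (2 ^+ n) ^+ 2 :> R by rewrite expr2 -exprMn -natrM.
have neq0 p : 2 ^+ p != 0 :> R by rewrite expf_neq0 ?pnatr_eq0.
move: normR (neq0 (L - n)%N) (neq0 n).
rewrite /dirx /diry pow2L !(rmorphD, rmorphM, rmorphXn, rmorphN) /= pow4.
move: (2 ^+ (L - n)) (2 ^+ n) (osq n.+1)%:~R (osq n)%:~R (Num.sqrt 15) sqrt15.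
move=> P Q u w r r2 norm P0 Q0.
have part1 : (a%:~R + P * (u - w) * m%:~R + (b%:~R + P * w * m%:~R) / 2) / (P * Q)
    - (a%:~R + b%:~R / 2) / (P * Q) = m%:~R * (u - w / 2) / Q :> R.
  by field; rewrite P0 Q0.
have part2 : (b%:~R + P * w * m%:~R) * (r / 2) / (P * Q) - b%:~R * (r / 2) / (P * Q)
    = m%:~R * w / 2 / Q * r :> R.
  by field; rewrite P0 Q0.
rewrite part1 part2 [in X in _ + X]exprMn r2.
transitivity (m%:~R ^+ 2 * (Q ^+ 2) / Q ^+ 2 : R); last by field.
by rewrite -[X in _ = _ * X / _]norm; field.
Qed.

Definition torus_vec n (a b : int) : 'I_n.+2 * 'I_n.+2 := (a%:~R, b%:~R).

Lemma torus_vecMz n a b m : torus_vec n a b *~ m = torus_vec n (a * m) (b * m).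
Proof.
rewrite [LHS]surjective_pairing (raddfMz (@fst 'I_n.+2 'I_n.+2)).
by rewrite (raddfMz (@snd 'I_n.+2 'I_n.+2)) /= -!mulrzA.
Qed.

Lemma torus_vecD n a b a' b' :
  torus_vec n a b + torus_vec n a' b' = torus_vec n (a + a') (b + b').
Proof. by rewrite /torus_vec !rmorphD. Qed.

(** Absence of wrap-around is what turns a torus translation into a translation of the plane. *)
Lemma val_ordDz n (x : 'I_n.+2) (z : int) : 0 <= x%:Z + z < n.+2%:Z ->
  ((x + z%:~R)%R : 'I_n.+2)%:Z = x%:Z + z.
Proof.
move=> /andP[ge0 lt_n].
have [m def_m] : exists m : nat, x%:Z + z = m%:Z.
  by exists (absz (x%:Z + z)); rewrite gez0_abs.
have m_lt : (m < n.+2)%N by move: lt_n; rewrite def_m.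
have -> : x + z%:~R = Ordinal m_lt; last by rewrite def_m.
rewrite -[x]natr_Zp -[Ordinal _]natr_Zp /= !pmulrn -rmorphD /=.
by congr (_%:~R).
Qed.

Lemma interior_shift (M P a : nat) (z : int) : P = (16 * M)%N ->
  (M <= a < M + 14 * M)%N -> (absz z < M)%N -> 0 <= a%:Z + z < P%:Z.
Proof. by lia. Qed.

Lemma card_ord_interval n (l m : nat) : (l + m <= n.+1)%N ->
  (m <= #|[set i : 'I_n.+1 | (l <= i < l + m)%N]%SET|)%N.
Proof.
move=> le_n.
have inj : injective (fun i : 'I_m => inord (l + i) : 'I_n.+1).
  move=> i j /(congr1 val); have := ltn_ord i; have := ltn_ord j => ? ?.
  by rewrite /= !inordK; [move/addnI/val_inj| lia | lia].
rewrite -[X in (X <= _)%N]card_ord -(card_imset predT inj).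
apply: subset_leq_card; apply/fintype.subsetP => _ /imsetP[i _ ->].
by have := ltn_ord i => ?; rewrite finset.in_set inordK; lia.
Qed.

Lemma odd_dist_neq (x y : 'rV[R]_2) : odd_integer (euclidean_dist x y) -> x <> y.
Proof.
case=> m dist xy; have := dist; rewrite xy /euclidean_dist.
under eq_bigr do rewrite subrr expr0n.
rewrite big1 // sqrtr0 => /eqP; rewrite eq_sym intr_eq0; lia.
Qed.

Lemma monochromatic_odd_distance (k : nat) :
  exists s : seq 'rV[R]_2, forall c : 'rV[R]_2 -> 'I_k,
    exists x y, [/\ x \in s, y \in s, odd_integer (euclidean_dist x y)
                 & c x = c y].
Proof.
have [->|k_gt0] := posnP k; first by exists [::] => c; case: (c 0).
(* With this [L] the count gives [4 |S| <= 3 |G|], whereas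
   [|S| / |G| >= (14/16)^2 = 49/64 > 3/4]. *)
pose L := (4 * k)%N.
pose size_rel d e := (`|(2 ^+ d * osq e)%R| + `|osq (d + e)| + `|(2 ^+ e * osq d)%R|)%N.
pose C := (\sum_(d < L) \sum_(e < L) size_rel d e)%N.
(* Large enough for the error [k (C / N) L^4] to be at most 1. *)
pose N := (k * C * L ^ 4).+1.
(* Fewer than [N] steps in a direction move each coordinate by less than [M], so they lead from the
   central square of side [14 M] to points still inside the torus of side [16 M]. *)
pose M := (N * \sum_(l < L) (`|dirx L l| + `|diry L l|)).+1.
pose n := (16 * M - 2)%N.
have n2 : n.+2 = (16 * M)%N by rewrite /n; lia.
pose G := ('I_n.+2 * 'I_n.+2)%type.
pose pt (g : G) := point L g.1%:Z g.2%:Z.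
exists [seq pt g | g <- enum {: G}] => c.
apply: contrapT => no_pair.
have proper g h : odd_integer (euclidean_dist (pt g) (pt h)) -> c (pt g) != c (pt h).
  move=> odd_gh; apply/eqP => cgh; apply: no_pair; exists (pt g), (pt h).
  by split=> //; apply: map_f; rewrite mem_enum.
pose v (l : 'I_L) : G := torus_vec n (dirx L l) (diry L l).
pose S := finset.setX [set i : 'I_n.+2 | (M <= i < M + 14 * M)%N]%SET
               [set i : 'I_n.+2 | (M <= i < M + 14 * M)%N]%SET.
have relation (i m j : 'I_L) : (i < m < j)%N ->
    exists a b c : int, [/\ ~~ odd `|a|, odd `|b|, ~~ odd `|c|,
      v m *~ b = v i *~ a + v j *~ c & (`|a| + `|b| + `|c| <= C)%N].
  move=> /andP[im mj].
  have [d def_m] : exists d, m = (i + d.+1)%N :> nat.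
    by exists (m - i).-1; lia.
  have [e def_j] : exists e, j = (i + d.+1 + e.+1)%N :> nat.
    by exists (j - m).-1; lia.
  (* Positive exponents of 2 make the outer coefficients even; a positive index makes the middle one
     odd. *)
  exists (2 ^+ d.+1 * osq e.+1), (osq (d.+1 + e.+1)), (2 ^+ e.+1 * osq d.+1).
  split; rewrite ?odd_osq //.
  - by rewrite exprS -mulrA abszM oddM.
  - by rewrite exprS -mulrA abszM oddM.
  - have := ltn_ord j; rewrite def_j => /ltnW lt_L.
    have [Ex Ey] := dir_relation lt_L.
    by rewrite /v def_m def_j !torus_vecMz torus_vecD Ex Ey.
  have dL : (d.+1 < L)%N by have := ltn_ord j; lia.
  have eL : (e.+1 < L)%N by have := ltn_ord j; lia.
  rewrite /C (bigD1 (Ordinal dL)) //= (bigD1 (Ordinal eL)) //= -[leqRHS]addnA.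
  exact: leq_addr.
have proper_S x l i j : x \in S -> (i < N)%N -> (j < N)%N -> odd i != odd j ->
    c (pt (x + v l *+ i)) != c (pt (x + v l *+ j)).
  rewrite !finset.in_set => /andP[/andP[x1l x1r] /andP[x2l x2r]] iN jN ne.
  have small (t : nat) : (t < N)%N ->
      (t * `|dirx L l| < M)%N /\ (t * `|diry L l| < M)%N.
    move=> tN.
    have le_sum : (`|dirx L l| + `|diry L l| <= \sum_(l < L) (`|dirx L l| + `|diry L l|))%N.
      by rewrite (bigD1 l) //= leq_addr.
    rewrite /M !ltnS; split; (apply: leq_mul; first exact: ltnW);
      by apply: leq_trans le_sum; rewrite ?leq_addr ?leq_addl.
  have ptE t : (t < N)%N -> pt (x + v l *+ t) =
      point L (x.1%:Z + dirx L l * t) (x.2%:Z + diry L l * t).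
    move=> tN; have [sx sy] := small t tN.
    have sx' : (absz (dirx L l * t%:Z)%R < M)%N by rewrite abszM mulnC.
    have sy' : (absz (diry L l * t%:Z)%R < M)%N by rewrite abszM mulnC.
    rewrite /pt /v pmulrn torus_vecMz /=.
    by rewrite !val_ordDz //; apply: (interior_shift n2); rewrite ?x1l ?x2l.
  apply: proper; rewrite !ptE //.
  have -> : x.1%:Z + dirx L l * i = x.1%:Z + dirx L l * j + dirx L l * (i%:Z - j%:Z) by ring.
  have -> : x.2%:Z + diry L l * i = x.2%:Z + diry L l * j + diry L l * (i%:Z - j%:Z) by ring.
  rewrite dist_point; last by rewrite ltnW.
  exists ((absz (i%:Z - j%:Z))./2 : int); congr (_%:~R).
  rewrite -abszE -[in LHS](odd_double_half (absz (i%:Z - j%:Z))).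
  by lia.
have card_S : ((14 * M) ^ 2 <= #|S|)%N.
  rewrite /S cardsX -mulnn.
  by apply: leq_mul; apply: card_ord_interval; rewrite n2; lia.
have card_G : #|{: 'I_n.+2 * 'I_n.+2}| = ((16 * M) ^ 2)%N.
  by rewrite card_prod card_ord n2 mulnn.
have := @color_count R ('I_n.+2 * 'I_n.+2)%type N (ltn0Sn _) k
  (fun g => c (pt g)) L C v S relation proper_S.
have k_neq0 : k%:R != 0 :> R by rewrite pnatr_eq0 -lt0n.
have -> : L%:R * #|S|%:R / k%:R = (4 * #|S|)%:R :> R.
  by rewrite /L !natrM; field.
have small_error : k%:R * (C%:R / N%:R) * (L ^ 4)%:R <= 1 :> R.
  rewrite mulrA mulrAC ler_pdivrMr ?ltr0n // mul1r -!natrM ler_nat.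
  exact: leqnSn.
rewrite card_G => count.
have : (4 * #|S|)%:R <= (3 * (16 * M) ^ 2)%:R :> R.
  apply: le_trans count _; rewrite natrM; apply: ler_wpM2r; first exact: ler0n.
  by move: small_error; lra.
rewrite ler_nat => count'.
have M_gt0 : (0 < M)%N by [].
by move: card_S count' M_gt0; rewrite !expnMn; move: (M ^ 2)%N (expn_gt0 M 2); lia.
Qed.

End Plane.

(** * Chromatic number exactly 6 *)

(** Colourings of the whole plane spare the induction on [s] a change of vertex type; points outside
    [s] get the default colour [ord0]. *)
Lemma colorable_seq (R : realType) (s : seq 'rV[R]_2) (j k : nat) :
  (j <= k.+1)%N -> colorable (odd_distance_graph [set` s]%classic) j ->
  exists c : 'rV[R]_2 -> 'I_k.+1, forall x y, x \in s -> y \in s ->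
    odd_integer (euclidean_dist x y) -> c x <> c y.
Proof.
move=> le_jk [c proper].
pose c' x : 'I_k.+1 := match pselect (x \in s) with
  | left xs => widen_ord le_jk (c (SigSub (mem_set xs : x \in [set` s]%classic)))
  | right _ => ord0
  end.
exists c' => x y xs ys odd_xy; rewrite /c'.
case: pselect => // xs'; case: pselect => // ys' /(congr1 val) /= /val_inj.
apply: proper; split=> //; move/(congr1 val) => /=; exact: odd_dist_neq.
Qed.

Theorem mainTheorem1 (R : realType) :
  exists V : set 'rV[R]_2,
    finite_set V /\ has_chromatic_number (odd_distance_graph V) 6.
Proof.
pose colorable5 (s : seq 'rV[R]_2) := exists c : 'rV[R]_2 -> 'I_5,
  forall x y, x \in s -> y \in s ->
    odd_integer (euclidean_dist x y) -> c x <> c y.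
have [x [s [ncol [c proper]]]] : exists x s, ~ colorable5 (x :: s) /\ colorable5 s.
  have [s mono] := monochromatic_odd_distance R 5.
  have : ~ colorable5 s.
    by case=> c proper; have [x [y [xs ys odd_xy]]] := mono c; apply: proper.
  (* Points are dropped from the head until the tail becomes 5-colourable; [x] is the last one
     dropped. *)
  elim: s {mono} => [|x s IHs] ncol; first by case: ncol; exists (fun=> ord0).
  by have [col_s|/IHs //] := pselect (colorable5 s); exists x, s.
exists [set` x :: s]%classic; split; first exact: finite_seq.
split=> [|j col_j]; last first.
  by rewrite ltnNge; apply/negP => le_j5; apply: ncol; apply: colorable_seq col_j.
(* The sixth colour is reserved for [x]. *)
exists (fun y => if val y == x then ord_max else widen_ord (leqnSn 5) (c (val y))).
move=> y z [yz odd_yz].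
have in_s (t : [set` x :: s]%classic) : val t != x -> val t \in s.
  by move=> tx; have := set_mem (valP t); rewrite /= inE (negPf tx).
case: eqP => [yx|/eqP yx]; case: eqP => [zx|/eqP zx].
- by case: yz; apply: val_inj; rewrite yx zx.
- by move=> /(congr1 val) /= E; have := ltn_ord (c (val z)); rewrite -E.
- by move=> /(congr1 val) /= E; have := ltn_ord (c (val y)); rewrite E.
by move=> /(congr1 val) /= /val_inj; apply: proper => //; apply: in_s.
Qed.
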